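(* There exist positive constants $c_m', r_m$ and $N_m\in\mathbb N$ depending only on $m$ such that for every $\theta\in\mathbb R$, every $r\ge r_m$ and every $n\ge N_m$, \[P(|\hat\theta_n-\theta|>r)\le r^{-c_m' n}.\] In particular, $\hat\theta_n\in L^{c_m' n-1}(\Omega,\mathcal F,P)$ for every $n\ge N_m$.
   Context: Fix $m>1/2$. Let $c_m:=\left(\int_{\mathbb R}(1+x^2)^{-m}\,dx\right)^{-1}$ and $f(x):=c_m(1+x^2)^{-m}$. For $\theta\in\mathbb R$, $\mathrm{PVII}_m(\theta,1)$ denotes the Pearson Type VII distribution with location $\theta$ and scale $1$, i.e. the law with density $x\mapsto f(x-\theta)$. Let $(X_n)_{n\ge1}$ be i.i.d. random variables on a probability space $(\Omega,\mathcal F,P)$ with law $\mathrm{PVII}_m(\theta,1)$. For each $n$, let $\hat\theta_n(x_1,\dots,x_n)$ be any Borel measurable function on $\mathbb R^n$ such that $\hat\theta_n(x_1,\dots,x_n)$ is a maximizer of $t\mapsto\prod_{i=1}^n f(x_i-t)$ over $t\in\mathbb R$, and let $\hat\theta_n:=\hat\theta_n(X_1,\dots,X_n)$ (the maximum likelihood estimator). *)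

(* Defs.v *)
From HB Require Import structures.
From mathcomp Require Import all_boot all_order all_algebra.
From mathcomp Require Import all_classical all_reals all_analysis.
Set Implicit Arguments. Unset Strict Implicit. Unset Printing Implicit Defensive.
Import Order.TTheory GRing.Theory Num.Theory.
Import numFieldNormedType.Exports.
Local Open Scope classical_set_scope.
Local Open Scope ring_scope.

Section PVII.
Variable R : realType.

Definition pvii_const (m : R) : R :=
  (Rintegral (@lebesgue_measure R) setT (fun x : R => (1 + x ^+ 2) `^ (- m)))^-1.

Definition pvii_pdf (m : R) (x : R) : R := pvii_const m * (1 + x ^+ 2) `^ (- m).

(* Borel sigma-algebra on R^n = product of Borel sigma-algebras on the
   coordinates (generated by the coordinate cylinders). *)
Definition borelRn (n : nat) : set (set ('I_n -> R)) :=
  <<s [set A | exists (i : 'I_n) (B : set R), measurable B /\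
               A = (fun x : 'I_n -> R => x i) @^-1` B] >>.
Arguments borelRn n : clear implicits.

Definition borel_measurable_Rn (n : nat) (F : ('I_n -> R) -> R) : Prop :=
  forall B : set R, measurable B -> borelRn n (F @^-1` B).

Definition is_mle (m : R) (n : nat) (x : 'I_n -> R) (t : R) : Prop :=
  forall s : R, \prod_(i < n) pvii_pdf m (x i - s) <= \prod_(i < n) pvii_pdf m (x i - t).

Context d (T : measurableType d) (P : probability T R).

Definition mutually_independent (X : nat -> T -> R) : Prop :=
  forall (s : seq nat) (B : nat -> set R), uniq s ->
    (forall i, measurable (B i)) ->
    P (\bigcap_(i in [set j | j \in s]) (X i @^-1` B i)) =
    (\prod_(i <- s) P (X i @^-1` B i))%E.

Definition has_law_pvii (m theta : R) (Y : T -> R) : Prop :=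
  measurable_fun setT Y /\
  forall B : set R, measurable B ->
    P (Y @^-1` B) = (\int[@lebesgue_measure R]_(x in B) (pvii_pdf m (x - theta))%:E)%E.

Definition iid_pvii (m theta : R) (X : nat -> T -> R) : Prop :=
  mutually_independent X /\ forall i, has_law_pvii m theta (X i).

End PVII.

(* Main.v *)
Require Import Defs.
From HB Require Import structures.
From mathcomp Require Import all_boot all_order all_algebra.
From mathcomp Require Import all_classical all_reals all_analysis.
From mathcomp Require Import measurable_realfun ring lra.
Set Implicit Arguments.
Unset Strict Implicit.
Unset Printing Implicit Defensive.
Import Order.TTheory GRing.Theory Num.Theory.
Import numFieldNormedType.Exports.
Local Open Scope classical_set_scope.
Local Open Scope ring_scope.

(** Write [Y_i = X_i - theta] and let [t] be the error of the estimator. Maximality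
    gives [\prod (1 + (Y_i - t)^2) <= \prod (1 + Y_i^2)]. With [g = 2|t|] and
    [16 s^2 <= |t|], an index with [|Y_i| <= s] contributes a factor at least [g] to
    the quotient of the two products, and any other index at least [g^-2]; so
    [|t| > 16 s^2] forces [|Y_i| > s] for at least [n/3] indices. Each of these
    events has probability [O(s^(1-2m))], and a union bound over the [2^n] index
    sets gives the polynomial tail. The moment bound is the tail formula for the
    expectation of [|t|^p]. *)

(** * Deterministic comparison of the factors *)

(** With u = |t|, the left side is at most 4 u s^2 <= u^2 / 4, while |y - t| >= u - s and s <= s^2
    <= u / 16 make the right side at least (15 u / 16)^2. *)
Lemma near_translate_le (R : realFieldType) (s t y : R) :
  1 <= s -> 16 * s ^+ 2 <= `|t| -> `|y| <= s ->
  2 * `|t| * (1 + y ^+ 2) <= 1 + (y - t) ^+ 2.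
Proof.
move=> s1 st ys.
have y2 : y ^+ 2 <= s ^+ 2.
  by rewrite -[y ^+ 2]real_normK ?num_real// ler_sqr// nnegrE; lra.
have dist : `|t| - s <= `|y - t| by have := lerB_dist t y; rewrite distrC; lra.
rewrite -[(y - t) ^+ 2]real_normK ?num_real//.
set u := `|t| in st dist *; set v := `|y - t| in dist *.
have : (u - s) ^+ 2 <= v ^+ 2 by rewrite ler_sqr// nnegrE; nra.
have : 2 * u * (1 + y ^+ 2) <= 2 * u * (2 * s ^+ 2) by apply: ler_wpM2l; nra.
have : 0 <= (u - 16 * s ^+ 2) * u by apply: mulr_ge0; nra.
have : 0 <= (s ^+ 2 - s) * u by apply: mulr_ge0; nra.
have : 0 <= (u - 16 * s ^+ 2) by lra.
nra.
Qed.

(** The square (y - 2t)^2 >= 0 is the inequality y^2 <= 2 (y - t)^2 + 2 t^2; the rest follows from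
    t^2 >= 1. *)
Lemma translate_le (R : realFieldType) (t y : R) : 1 <= `|t| ->
  1 + y ^+ 2 <= (2 * `|t|) ^+ 2 * (1 + (y - t) ^+ 2).
Proof.
move=> t1; rewrite exprMn [`|t| ^+ 2]real_normK ?num_real//.
have t2 : 1 <= t ^+ 2 by rewrite -[t ^+ 2]real_normK ?num_real// exprn_ege1.
have : 0 <= (t ^+ 2 - 1) * (y - t) ^+ 2 by rewrite mulr_ge0// ?sqr_ge0// subr_ge0.
have : 0 <= (y - 2 * t) ^+ 2 by exact: sqr_ge0.
nra.
Qed.

(* If k of the n points are far from 0, the factors compare as
   g^n \prod (1 + y^2) <= g^(3k) \prod (1 + (y - t)^2), where g = 2|t|. *)
Lemma card_far_ge (R : realFieldType) (n : nat) (y : 'I_n -> R) (s t : R) :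
  1 <= s -> 16 * s ^+ 2 <= `|t| ->
  \prod_(i < n) (1 + (y i - t) ^+ 2) <= \prod_(i < n) (1 + y i ^+ 2) ->
  (n <= 3 * #|[set i | (s < `|y i|)%R]%SET|)%N.
Proof.
move=> s1 st; set far := [set i | _]%SET; set g := 2 * `|t| => prodle.
have t1 : 1 <= `|t| by nra.
have g1 : 1 < g by rewrite /g; lra.
have pos (x : R) : 0 < 1 + x ^+ 2 by have := sqr_ge0 x; lra.
(* A far index costs g^3: g^2 from [translate_le], and one more g to match the factor g that every
   index carries on the left. *)
have : \prod_(i < n) (g * (1 + y i ^+ 2)) <=
       \prod_(i < n) ((if i \in far then g ^+ 3 else 1) * (1 + (y i - t) ^+ 2)).
  apply: ler_prod => i _; apply/andP; split.
    by rewrite mulr_ge0 ?ltW//; lra.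
  rewrite inE; case: ltP => yi; last by rewrite mul1r (near_translate_le s1).
  rewrite [g ^+ 3]exprS -mulrA ler_wpM2l//; first lra.
  exact: translate_le.
clearbody g; have g0 : 0 <= g by lra.
rewrite !big_split/= prodr_const card_ord -big_mkcond/= prodr_const -exprM.
(* Maximality puts the same positive product on both sides; it cancels, and g > 1 lets the exponents
   n and 3k be compared. *)
move=> /le_trans/(_ (ler_wpM2l (exprn_ge0 _ g0) prodle)).
rewrite ler_pM2r; last by apply: prodr_gt0 => i _.
by rewrite ler_eXn2l.
Qed.

Lemma measurable_norm_gt d (T : measurableType d) (R : realType) (f : T -> R) (s : R) :
  measurable_fun setT f -> measurable [set x | s < `|f x|].
Proof.
move=> mf; have mnf : measurable_fun setT (fun x => `|f x|).
  exact: measurableT_comp.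
have := mnf measurableT _ (measurable_itv `]s, +oo[).
by rewrite setTI preimage_itvoy.
Qed.

(** * Polynomial tail of the density *)

Section tail.
Context {R : realType}.
Local Notation mu := (@lebesgue_measure R).

Lemma is_derive1_powR_shift (p theta x : R) : theta < x ->
  is_derive x 1 (fun x => (x - theta) `^ p) (p * (x - theta) `^ (p - 1)).
Proof.
rewrite -subr_gt0 => x0.
have shift : is_derive x 1 (fun x => x - theta) 1.
  by apply: is_derive_eq; rewrite subr0.
have := @is_derive1_comp R (fun y => y `^ p) (fun x => x - theta) x _ _
  (is_derive1_powR p x0) shift.
by rewrite mulr1.
Qed.

Lemma cvg_powR_shift_pinfty (p theta : R) : 0 < p ->
  (x - theta) `^ (- p) @[x --> +oo] --> 0.
Proof.
move=> p0; apply/cvgr0Pnorm_lt => e e0.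
exists (theta + e `^ (- p^-1)); split; first exact: num_real.
move=> x; rewrite -ltrBrDl => xe.
have e1 : 0 < e `^ (- p^-1) by exact: powR_gt0.
have xt0 : 0 < x - theta by exact: lt_trans xe.
rewrite ger0_norm ?powR_ge0// powRN invf_plt ?posrE ?powR_gt0//.
have := gt0_ltr_powR p0 (ltW e1) (ltW xt0) xe.
by rewrite -powRrM mulNr mulVf ?gt_eqF// powRN powRr1 ?ltW.
Qed.

(** Fundamental theorem of calculus on a half-line; the antiderivative [F] vanishes at infinity
    because a > 1. It serves the density tail and, with [theta] = 0, the moment integral. *)
Lemma integral_powR_itvcy (a theta s : R) : 1 < a -> 0 < s ->
  (\int[mu]_(x in `[(theta + s)%R, +oo[) ((x - theta) `^ (- a))%:E =
   (s `^ (1 - a) / (a - 1))%:E)%E.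
Proof.
move=> a1 s0.
have xt x : theta + s <= x -> theta < x by lra.
pose F x : R := - ((a - 1)^-1 * (x - theta) `^ (1 - a)).
have dF x : theta + s <= x -> is_derive x 1 F ((x - theta) `^ (- a)).
  move=> /xt /(@is_derive1_powR_shift (1 - a)) /(is_deriveZ (a - 1)^-1) /is_deriveN.
  congr is_derive; rewrite (_ : 1 - a - 1 = - a); last by ring.
  rewrite -[_ *: _]/(_ * _); field; lra.
have cts (f : R -> R) (x df : R) : is_derive x 1 f df -> {for x, continuous f}.
  by case=> ? _; apply/differentiable_continuous/derivable1_diffP.
rewrite (@ge0_continuous_FTC2y _ _ F _ 0).
- by rewrite /F addrAC subrr add0r -EFinN opprK add0r mulrC.
- by move=> x _; exact: powR_ge0.
- apply: continuous_in_subspaceT => x; rewrite inE/= in_itv/= andbT => /xt sx.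
  exact/cts/is_derive1_powR_shift.
- rewrite -oppr0; apply: cvgN; rewrite -(mulr0 (a - 1)^-1); apply: cvgMl_tmp.
  by rewrite -opprB; apply: cvg_powR_shift_pinfty; rewrite subr_gt0.
- by move=> x /ltW/dF[].
- by apply: cvg_at_right_filter; apply: cts (dF _ _).
- by move=> x; rewrite in_itv/= andbT => /ltW/dF[_]; rewrite derive1E.
Qed.

Lemma pvii_const_ge0 (m : R) : 0 <= pvii_const m.
Proof. by rewrite invr_ge0; apply: Rintegral_ge0 => x _; exact: powR_ge0. Qed.

Lemma pvii_pdf_ge0 (m x : R) : 0 <= pvii_pdf m x.
Proof. by rewrite mulr_ge0 ?powR_ge0 ?pvii_const_ge0. Qed.

Lemma continuous_pvii_pdf_shift (m theta : R) :
  continuous (fun x => pvii_pdf m (x - theta)).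
Proof.
move=> x; apply: cvgMl_tmp.
apply: (@continuous_comp _ _ _ (fun x => 1 + (x - theta) ^+ 2) (fun y => y `^ (- m))).
  apply: cvgD; first exact: cvg_cst.
  have xt : y - theta @[y --> x] --> x - theta.
    by apply: cvgB; [exact: cvg_id|exact: cvg_cst].
  exact: (cvgM xt xt).
apply/differentiable_continuous/derivable1_diffP.
by apply: derivable_powR; rewrite in_itv/= ltr_pwDl// sqr_ge0.
Qed.

Lemma measurable_pvii_pdf_shift (m theta : R) (D : set R) : measurable D ->
  measurable_fun D (EFin \o (fun x : R => pvii_pdf m (x - theta))).
Proof.
move=> mD; apply/measurable_EFinP/(@measurable_funS _ _ _ _ setT) => //.
apply: continuous_measurable_fun.
exact: continuous_pvii_pdf_shift.
Qed.

(** Since 1 + u^2 >= u^2, the density at u > 0 is at most its constant times u^(-2m), which is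
    integrable at infinity because 2m > 1. *)
Lemma pvii_half_tail_le (m theta s : R) : 1 / 2 < m -> 0 < s ->
  (\int[mu]_(x in `[(theta + s)%R, +oo[) (pvii_pdf m (x - theta))%:E <=
   (pvii_const m * (s `^ (1 - 2 * m) / (2 * m - 1)))%:E)%E.
Proof.
move=> m1 s0.
have mpow (p : R) : measurable_fun `[(theta + s)%R, +oo[%classic
    (EFin \o (fun x : R => (x - theta) `^ p)).
  apply/measurable_EFinP/(@measurableT_comp _ _ _ _ _ _ (fun y => y `^ p)) => //.
  exact: measurable_funB.
rewrite EFinM -(@integral_powR_itvcy _ theta)//; last lra.
rewrite -ge0_integralZl//=; last 3 first.
- exact: (mpow (- (2 * m))).
- by move=> x _; rewrite lee_fin powR_ge0.
- by rewrite lee_fin pvii_const_ge0.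
apply: ge0_le_integral => //=.
- by move=> x _; rewrite lee_fin pvii_pdf_ge0.
- exact: measurable_pvii_pdf_shift.
- by apply: measurable_funeM; exact: (mpow (- (2 * m))).
- move=> x; rewrite in_itv/= andbT => sx; rewrite lee_fin ler_wpM2l ?pvii_const_ge0//.
  rewrite -mulrN powRrM powR_mulrn; last lra.
  rewrite !powRN lef_pV2 ?posrE ?powR_gt0//; [|nra|nra].
  by apply: ge0_ler_powR; rewrite ?nnegrE; nra.
Qed.

Lemma pvii_tail_le (m theta s : R) : 1 / 2 < m -> 0 < s ->
  (\int[mu]_(x in [set x | (s < `|x - theta|)%R]) (pvii_pdf m (x - theta))%:E <=
   (2 * pvii_const m / (2 * m - 1) * s `^ (1 - 2 * m))%:E)%E.
Proof.
move=> m1 s0.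
apply: (@le_trans _ _ (\int[mu]_(x in `]-oo, (theta - s)%R] `|` `[(theta + s)%R, +oo[)
   (pvii_pdf m (x - theta))%:E)%E).
  apply: ge0_subset_integral => //=.
  - by apply: measurable_norm_gt; exact: measurable_funB.
  - exact: measurableU.
  - by apply: measurable_pvii_pdf_shift; exact: measurableU.
  - by move=> x _; rewrite lee_fin pvii_pdf_ge0.
  - move=> x /=; rewrite !in_itv/= andbT lter_normr => /orP[]; [right|left]; lra.
rewrite ge0_integral_setU//=; last 3 first.
- by apply: measurable_pvii_pdf_shift; exact: measurableU.
- by move=> x _; rewrite lee_fin pvii_pdf_ge0.
- apply/disj_setPS => x /=; rewrite !in_itv/= andbT => -[]; lra.
have -> : 2 * pvii_const m / (2 * m - 1) * s `^ (1 - 2 * m) =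
  pvii_const m * (s `^ (1 - 2 * m) / (2 * m - 1)) +
  pvii_const m * (s `^ (1 - 2 * m) / (2 * m - 1)) by ring.
rewrite EFinD; apply: leeD; last exact: pvii_half_tail_le.
(* Reflection x -> -x and evenness of the density turn the left tail around [theta] into the right
   tail around [- theta]. *)
have -> : theta - s = - (- theta + s) by ring.
rewrite ge0_integration_by_substitutionNy//; last 2 first.
- exact/continuous_subspaceT/continuous_pvii_pdf_shift.
- by move=> x _; exact: pvii_pdf_ge0.
under eq_integral => x _.
  rewrite /= (_ : pvii_pdf m (- x - theta) = pvii_pdf m (x - - theta)); last first.
    by rewrite /pvii_pdf opprK -opprD sqrrN.
  over.
exact: pvii_half_tail_le.
Qed.
End tail.

(** * Measurability of the estimator and a union bound *)

(** The sets with measurable preimage under the joint map [G] form a sigma-algebra containing the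
    coordinate cylinders, hence all of [borelRn]. *)
Lemma measurable_borelRn_comp (R : realType) d (T : measurableType d) (n : nat)
    (F : ('I_n -> R) -> R) (Y : 'I_n -> T -> R) :
  borel_measurable_Rn F -> (forall i, measurable_fun setT (Y i)) ->
  measurable_fun setT (fun w => F (fun i => Y i w)).
Proof.
move=> mF mY _ B mB; pose G w i := Y i w.
suff : borelRn (n := n) `<=` image_set_system setT G measurable.
  by move=> /(_ _ (mF _ mB)).
apply: smallest_sub.
  exact/sigma_algebra_image/sigma_algebra_measurable.
by move=> _ [i [C [mC ->]]]; exact: mY.
Qed.

Lemma measure_bigsetU_le d (T : measurableType d) (R : realType)
    (mu : {measure set T -> \bar R}) (I : Type) (r : seq I) (Q : pred I) (A : I -> set T) :
  (forall i, measurable (A i)) ->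
  (mu (\big[setU/set0]_(i <- r | Q i) A i) <= \sum_(i <- r | Q i) mu (A i))%E.
Proof.
move=> mA; elim: r => [|i r IHr]; first by rewrite !big_nil measure0.
rewrite !big_cons; case: ifP => // _; apply: (le_trans (measureU2 _ _ _)) => //.
  by apply: bigsetU_measurable => j _.
by rewrite leeD2l.
Qed.

Lemma prode_le_exp (R : realType) (I : Type) (s : seq I) (p : I -> \bar R) (x : R) :
  (forall i, 0 <= p i)%E -> (forall i, p i <= x%:E)%E ->
  (\prod_(i <- s) p i <= (x ^+ size s)%:E)%E.
Proof.
move=> p0 px; elim: s => [|i s IHs]; first by rewrite big_nil expr0.
rewrite big_cons exprS EFinM; apply: lee_pmul => //.
exact: prode_ge0.
Qed.

(* Union bound over the 2^n possible sets of indices of the occurring events. *)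
Lemma independent_card_le d (T : measurableType d) (R : realType)
    (P : probability T R) (X : nat -> T -> R) (B : nat -> set R)
    (n k : nat) (q : R) (E : set T) :
  mutually_independent P X -> (forall i, measurable_fun setT (X i)) ->
  (forall i, measurable (B i)) -> 0 <= q <= 1 ->
  (forall i, P (X i @^-1` B i) <= (q ^+ k)%:E)%E -> measurable E ->
  (forall w, E w -> exists2 S : {set 'I_n}, (n <= k * #|S|)%N &
     forall i, i \in S -> B i (X i w)) ->
  (P E <= ((2 * q) ^+ n)%:E)%E.
Proof.
move=> indep mX mB /andP[q0 q1] Pq mE ES.
(* Independence is stated for duplicate-free lists of naturals, so [S] is listed through [val]. *)
pose A (S : {set 'I_n}) :=
  \bigcap_(i in [set j | j \in map val (enum S)]) (X i @^-1` B i).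
have mA S : measurable (A S).
  apply: bigcap_measurableType => i _.
  by rewrite -[X in measurable X]setTI; exact: mX.
pose Q (S : {set 'I_n}) := (n <= k * #|S|)%N.
apply: (@le_trans _ _ (P (\big[setU/set0]_(S | Q S) A S))).
  apply: le_measure; rewrite ?inE//; first exact: bigsetU_measurable.
  move=> w /ES[S QS BS]; rewrite -bigcup_seq_cond/=; exists S => //=.
    by rewrite mem_index_enum.
  by move=> _ /mapP[i + ->]; rewrite mem_enum => /BS.
apply: (le_trans (measure_bigsetU_le _ _ _ mA)).
apply: (@le_trans _ _ (\sum_(S : {set 'I_n} | Q S) (q ^+ n)%:E)%E).
  apply: lee_sum => S QS.
  have uS : uniq (map val (enum S)).
    by rewrite map_inj_uniq ?enum_uniq//; exact: val_inj.
  (* By independence the probability is at most (q^k)^|S|, and this is at most q^n since q <= 1 and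
     n <= k|S|. *)
  have := prode_le_exp (map val (enum S)) (fun i => measure_ge0 P _) Pq.
  rewrite -(indep _ B uS mB) size_map -cardE -exprM => /le_trans; apply.
  by rewrite lee_fin; exact: ler_wiXn2l.
apply: (@le_trans _ _ (\sum_(S : {set 'I_n}) (q ^+ n)%:E)%E).
  rewrite big_mkcond; apply: lee_sum => S _; case: ifP => // _.
  by rewrite lee_fin exprn_ge0.
rewrite sumEFin sumr_const lee_fin exprMn.
rewrite -cardsT -powersetT card_powerset cardsT card_ord.
by rewrite -natrX mulr_natl.
Qed.

(** * From the likelihood to the tail of the estimator *)

Lemma powR_prod (R : realType) (I : Type) (r : seq I) (Q : pred I) (f : I -> R) (p : R) :
  (forall i, 0 <= f i) ->
  \prod_(i <- r | Q i) (f i `^ p) = (\prod_(i <- r | Q i) f i) `^ p.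
Proof.
move=> f0; elim: r => [|i r IHr]; first by rewrite !big_nil powR1.
rewrite !big_cons; case: ifP => // _.
by rewrite powRM ?IHr// prodr_ge0.
Qed.

(** The likelihood is a positive constant times the power -m of the product, hence strictly
    decreasing in that product. *)
Lemma is_mle_prod_le (R : realType) (m : R) (n : nat) (x : 'I_n -> R) (t s : R) :
  0 < m -> 0 < pvii_const m -> is_mle m x t ->
  \prod_(i < n) (1 + (x i - t) ^+ 2) <= \prod_(i < n) (1 + (x i - s) ^+ 2).
Proof.
move=> m0 c0 /(_ s).
have pos (u : R) : 0 < 1 + u ^+ 2 by have := sqr_ge0 u; lra.
have prod0 (u : R) : 0 < \prod_(i < n) (1 + (x i - u) ^+ 2).
  exact: prodr_gt0.
have pdfE (u : R) : \prod_(i < n) pvii_pdf m (x i - u) =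
    pvii_const m ^+ n / (\prod_(i < n) (1 + (x i - u) ^+ 2)) `^ m.
  rewrite big_split/= prodr_const card_ord powR_prod ?powRN// => i.
  exact: ltW.
rewrite !pdfE ler_pM2l ?exprn_gt0// lef_pV2 ?posrE ?powR_gt0//.
rewrite !leNgt; apply: contra => lt_st.
by apply: gt0_ltr_powR; rewrite ?nnegrE ?ltW.
Qed.

(** The constant could a priori be a default 0, as [Rintegral] sends an infinite integral to 0 and
    the inverse of 0 is 0. A zero constant would give total mass 0 instead of 1. *)
Lemma has_law_pvii_const_gt0 (R : realType) d (T : measurableType d)
    (P : probability T R) (m theta : R) (Y : T -> R) :
  has_law_pvii P m theta Y -> 0 < pvii_const m.
Proof.
move=> [_ /(_ setT measurableT)]; rewrite preimage_setT probability_setT => law.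
rewrite lt_def pvii_const_ge0 andbT; apply/eqP => c0.
move: law; rewrite integral0_eq; last by move=> x _; rewrite /pvii_pdf c0 mul0r.
by move=> /eqP; rewrite onee_eq0.
Qed.

(** The right side is q^3 for the q of the union bound, with r = 16 s^2. It decays only like
    s^(-e/2), so for large s it dominates the tail of one observation. *)
Lemma powR_tail_small (R : realType) (K e : R) : 0 <= K -> 0 < e ->
  exists2 s0 : R, 1 <= s0 & forall s, s0 <= s ->
    K * s `^ (- e) <= ((16 * s ^+ 2) `^ (- (e / 12)) / 2) ^+ 3.
Proof.
(* The right side equals s^(-e/2) / (8 v), so the claim amounts to M <= s^(e/2); this dictates the
   threshold M^(2/e). *)
move=> K0 e0; pose v : R := 2 `^ e; pose M := 8 * K * v.
have v0 : 0 < v by rewrite powR_gt0.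
have M0 : 0 <= M by rewrite !mulr_ge0// ltW.
exists (Num.max 1 (M `^ (2 / e))); first by rewrite le_max lexx.
move=> s; rewrite ge_max => /andP[s1 sM].
have s0 : 0 < s by lra.
have sM2 : M <= s `^ (e / 2).
  have := @ge0_ler_powR _ (e / 2) _ _ _ _ _ sM.
  rewrite -powRrM (_ : 2 / e * (e / 2) = 1) ?powRr1//; last by field; lra.
  by apply; rewrite ?nnegrE ?powR_ge0//; lra.
have -> : 16 * s ^+ 2 = (4 * s) `^ 2.
  by rewrite powR_mulrn; [ring|lra].
rewrite -powRrM exprMn -powR_mulrn ?powR_ge0// -powRrM.
have -> : 2 * - (e / 12) * 3%:R = - (e / 2) by field.
rewrite powRM; [|lra|lra].
have -> : 4 `^ (- (e / 2)) = v^-1.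
  have -> : 4 = 2 `^ 2 :> R by rewrite powR_mulrn; [ring|lra].
  by rewrite -powRrM -powRN; congr (_ `^ _); field.
have -> : - e = - (e / 2) - e / 2 by field.
rewrite powRD; last by rewrite (gt_eqF s0) implybT.
rewrite !powRN; set u := s `^ (e / 2) in sM2 *.
have u0 : 0 < u by rewrite powR_gt0.
rewrite -subr_ge0 (_ : _ - _ = (u - M) / (8 * v * u ^+ 2)); last first.
  by rewrite /M; field; lra.
by rewrite divr_ge0 ?subr_ge0// !mulr_ge0 ?exprn_ge0 ?ltW.
Qed.

Lemma mle_tail_le (R : realType) (m : R) : 1 / 2 < m ->
  exists c r0 : R, [/\ 0 < c, 1 <= r0 &
    forall d (T : measurableType d) (P : probability T R) (theta : R)
      (X : nat -> T -> R) (n : nat) (F : ('I_n -> R) -> R),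
      iid_pvii P m theta X -> borel_measurable_Rn F ->
      (forall x, is_mle m x (F x)) ->
      forall r : R, r0 <= r ->
      (P [set w | (r < `|F (fun i => X i w) - theta|)%R] <=
       (r `^ (- (c * n%:R)))%:E)%E].
Proof.
move=> m1; have e0 : 0 < 2 * m - 1 by lra.
have K0 : 0 <= 2 * pvii_const m / (2 * m - 1).
  by rewrite !mulr_ge0 ?pvii_const_ge0 ?invr_ge0// ltW.
have [s0 s01 tail] := powR_tail_small K0 e0.
(* With e = 2m - 1, one observation has tail s^(-e), about r^(-e/2). Half the exponent absorbs the
   constants, and the cube root due to the n/3 far indices leaves r^(-e/12). *)
exists ((2 * m - 1) / 12), (16 * s0 ^+ 2); split; [lra|nra|].
set c := _ / 12 in tail *.
move=> d T P theta X n F [indep law] mF mle r r0r.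
have mX i : measurable_fun setT (X i) by case: (law i).
have c0 : 0 < pvii_const m := has_law_pvii_const_gt0 (law 0).
have r_gt0 : 0 < r by nra.
have [s s_ge0 rs] : exists2 s, 0 <= s & r = 16 * s ^+ 2.
  exists (Num.sqrt r / 4); first by rewrite divr_ge0// sqrtr_ge0.
  by rewrite exprMn sqr_sqrtr; [field|exact: ltW].
have s0s : s0 <= s by rewrite -ler_sqr ?nnegrE; lra.
have s1 : 1 <= s by lra.
(* The 1/2 pays for the 2^n index sets: (2q)^n = r^(-cn). *)
pose q := r `^ (- c) / 2.
have rc1 : r `^ (- c) <= 1.
  rewrite powRN invf_le1 ?powR_gt0// -[1](powRr0 r).
  by apply: ler_powR; [nra|rewrite /c; lra].
rewrite (_ : r `^ (- (c * n%:R)) = (2 * q) ^+ n); last first.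
  rewrite /q mulrCA divff// mulr1 -powR_mulrn ?powR_ge0// -powRrM.
  by congr (_ `^ _); ring.
pose B (i : nat) := [set x : R | s < `|x - theta|].
have mB i : measurable (B i).
  by apply: measurable_norm_gt; exact: measurable_funB.
apply: (@independent_card_le _ _ _ _ X B _ 3) => //.
- by rewrite /q; have := powR_ge0 r (- c); lra.
- move=> i; case: (law i) => _ ->//.
  apply: (le_trans (pvii_tail_le _ _ _)) => //; first lra.
  by rewrite lee_fin /q rs -[1 - 2 * m]opprB; exact: tail.
- apply: measurable_norm_gt; apply: measurable_funB => //.
  exact: measurable_borelRn_comp.
move=> w /= rF; exists [set i : 'I_n | (s < `|X i w - theta|)%R]%SET; last first.
  by move=> i; rewrite inE.
apply: (@card_far_ge _ _ _ s (F (fun i => X i w) - theta)) => //.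
  by rewrite -rs ltW.
(* The shifts by [theta] cancel, leaving the comparison of the maximizer with the true location. *)
under eq_bigr do rewrite opprB addrA subrK.
by apply: (@is_mle_prod_le _ m) => //; lra.
Qed.

(** * From the tail bound to moments *)

(** The expectation of |Z|^p is the integral of P(|Z|^p > x) over x >= 0. The integrand is at most 1
    below r0^p and at most x^(-a/p) beyond, where a/p > 1. *)
Lemma finite_norm_of_tail (R : realType) d (T : measurableType d)
    (P : probability T R) (Z : T -> R) (p a r0 : R) :
  measurable_fun setT Z -> 0 < p -> p < a -> 0 < r0 ->
  (forall r, r0 <= r ->
     (P [set w | (r < `|Z w|)%R] <= (r `^ (- a))%:E)%E) ->
  finite_norm P p%:E Z.
Proof.
move=> mZ p0 pa r00 tail.
pose Y w := `|Z w| `^ p.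
have mY : measurable_fun setT Y.
  apply: (@measurableT_comp _ _ _ _ _ _ (fun y => y `^ p)) => //.
  exact: measurableT_comp.
pose X : {RV P >-> R} := HB.pack Y (isMeasurableFun.Build _ _ _ _ _ mY).
have b0 : 0 < r0 `^ p by rewrite powR_gt0.
have EX : ('E_P[X] < +oo)%E.
  rewrite ge0_expectation_ccdf; last by move=> w; exact: powR_ge0.
  have mccdf (D : set R) : measurable D -> measurable_fun D (ccdf X).
    by move=> mD; apply: (@measurable_funS _ _ _ _ setT) => //; exact: ccdf_measurable.
  rewrite (_ : `[0, +oo[%classic = `[0, r0 `^ p[ `|` `[r0 `^ p, +oo[); last first.
    by rewrite -itv_bndbnd_setU// bnd_simp ltW.
  rewrite ge0_integral_setU//=; last 2 first.
  - by apply: mccdf; exact: measurableU.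
  - apply/disj_setPS => x /=; rewrite !in_itv/= andbT => -[/andP[_ xb] bx].
    by move: (lt_le_trans xb bx); rewrite ltxx.
  apply: lte_add_pinfty.
  - apply: (@le_lt_trans _ _ (\int[lebesgue_measure]_(x in `[0%R, (r0 `^ p)%R[) 1)%E).
      apply: ge0_le_integral => //=; first exact: mccdf.
      by move=> x _; exact: probability_le1.
    rewrite integral_cst//= mul1e lebesgue_measure_itv/=.
    by case: ifP; rewrite ?ltry.
  - have ap1 : 1 < a / p by rewrite ltr_pdivlMr ?mul1r.
    have := @integral_powR_itvcy _ (a / p) 0 _ ap1 b0; rewrite add0r => Ipow.
    apply: (@le_lt_trans _ _ (\int[lebesgue_measure]_(x in `[(r0 `^ p)%R, +oo[)
      ((x - 0) `^ (- (a / p)))%:E)%E); last by rewrite Ipow ltry.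
    apply: ge0_le_integral => //=.
    + exact: mccdf.
    + apply/measurable_EFinP/(@measurableT_comp _ _ _ _ _ _ (fun y => y `^ _)) => //.
      exact: measurable_funB.
    + move=> x; rewrite in_itv/= andbT => rx; rewrite subr0.
      have x0 : 0 < x by exact: lt_le_trans rx.
      (* The tail hypothesis is applied at radius x^(1/p). *)
      have rxp : r0 <= x `^ p^-1.
        have := @ge0_ler_powR _ p^-1 _ _ _ _ _ rx.
        rewrite -powRrM mulfV ?gt_eqF// powRr1; last exact: ltW.
        by apply; rewrite ?nnegrE ?invr_ge0 ltW.
      have := tail _ rxp; rewrite -powRrM mulrN [p^-1 * a]mulrC; apply: le_trans.
      rewrite -[ccdf X x]/(P (Y @^-1` `]x, +oo[)).
      apply: le_measure; rewrite ?inE.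
      * by rewrite -[X in measurable X]setTI; exact: (mY measurableT).
      * exact: measurable_norm_gt.
      move=> w /=; rewrite in_itv/= andbT => xZ.
      have := @gt0_ltr_powR _ p^-1 _ _ _ _ _ xZ.
      rewrite -[Y w `^ _]powRrM mulfV ?gt_eqF// powRr1//; apply.
      - by rewrite invr_gt0.
      - by rewrite nnegrE ltW.
      - by rewrite nnegrE powR_ge0.
rewrite /finite_norm unlock /=.
apply: poweR_lty.
by move: EX; rewrite unlock.
Qed.

(** The tail bound controls the centred estimator; Minkowski's inequality, for p >= 1, adds the
    constant [theta] back. *)
Lemma finite_norm_shift (R : realType) d (T : measurableType d)
    (P : probability T R) (Z : T -> R) (p theta : R) : 1 <= p ->
  measurable_fun setT Z -> finite_norm P p%:E (fun w => Z w - theta) ->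
  finite_norm P p%:E Z.
Proof.
move=> p1 mZ fZ.
have -> : Z = ((fun w => Z w - theta) \+ cst theta)%R.
  by apply/funext => w /=; rewrite subrK.
apply: le_lt_trans (minkowski_EFin _ _ _ _) _ => //.
  exact: measurable_funB.
apply: lte_add_pinfty => //.
rewrite unlock /=; apply: poweR_lty.
by rewrite integral_cst//= probability_setT mule1 ltry.
Qed.

Theorem theorem1p5 (R : realType) (m : R) (hm : 1 / 2 < m) :
  exists (c r0 : R) (N : nat), 0 < c /\ 0 < r0 /\ (0 < N)%N /\
    forall (d : measure_display) (T : measurableType d) (P : probability T R)
      (theta : R) (X : nat -> T -> R)
      (est : forall n : nat, ('I_n -> R) -> R),
      iid_pvii P m theta X ->
      (forall n, borel_measurable_Rn (est n)) ->
      (forall n (x : 'I_n -> R), is_mle m x (est n x)) ->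
      (forall (r : R) (n : nat), r0 <= r -> (N <= n)%N ->
         (P [set w | (r < `| est n (fun i : 'I_n => X i w) - theta |)%R] <=
           (r `^ (- (c * n%:R)))%:E)%E) /\
      (forall n : nat, (N <= n)%N ->
         measurable_fun setT (fun w => est n (fun i : 'I_n => X i w)) /\
         finite_norm P ((c * n%:R - 1)%:E) (fun w => est n (fun i : 'I_n => X i w))).
Proof.
have [c [r0 [c0 r01 tail]]] := mle_tail_le hm.
have r0_gt0 : 0 < r0 by lra.
(* For n beyond 2/c the order cn - 1 is at least 1, as Minkowski's inequality requires. *)
have bound : 2 / c < (Num.bound (2 / c))%:R.
  by apply: archi_boundP; rewrite divr_ge0// ltW.
exists c, r0, (Num.bound (2 / c)); split=> //; split=> //; split.
  by rewrite -(ltr_nat R); apply: le_lt_trans bound; rewrite divr_ge0// ltW.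
move=> d T P theta X est iid mest mle.
have mX i : measurable_fun setT (X i) by case: iid => _ /(_ i)[].
have mT n : measurable_fun setT (fun w => est n (fun i : 'I_n => X i w)).
  by apply: measurable_borelRn_comp => // i; exact: mX.
have tailn n := tail _ _ _ _ _ _ (est n) iid (mest n) (mle n).
split=> [r n r0r _|n Nn]; first exact: tailn.
split; first exact: mT.
have cn : 2 <= c * n%:R.
  rewrite -ler_pdivrMl// mulrC (le_trans (ltW bound))// ler_nat.
  exact: Nn.
apply: (@finite_norm_shift _ _ _ _ _ _ theta); [lra|exact: mT|].
apply: (@finite_norm_of_tail _ _ _ _ _ _ (c * n%:R) r0) => //; [|lra|lra|].
  exact: measurable_funB.
exact: tailn.
Qed.
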